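(* Let $q$ be complex with $|q|<1$ and define $$V_1(q)=q^{3}\frac{\mathfrak f(-q,-q^{27})}{\mathfrak f(-q^{13},-q^{15})},\quad V_2(q)=q^{2}\frac{\mathfrak f(-q^3,-q^{25})}{\mathfrak f(-q^{11},-q^{17})},\quad V_3(q)=q\frac{\mathfrak f(-q^5,-q^{23})}{\mathfrak f(-q^{9},-q^{19})}.$$ Then \begin{enumerate} \item[(i)] $\dfrac{1}{V_1(q)}-V_1(q)=\dfrac{\phi(q^7)\,\mathfrak f(-q^6,-q^8)}{q^3\psi(q^{14})\,\mathfrak f(-q,-q^{13})}$, \item[(ii)] $\dfrac{1}{V_1(q)}+V_1(q)=\dfrac{\phi(-q^7)\,\mathfrak f(q^6,q^8)}{q^3\psi(q^{14})\,\mathfrak f(-q,-q^{13})}$, \item[(iii)] $\dfrac{1}{V_2(q)}-V_2(q)=\dfrac{\phi(q^7)\,\mathfrak f(-q^4,-q^{10})}{q^2\psi(q^{14})\,\mathfrak f(-q^3,-q^{11})}$, \item[(iv)] $\dfrac{1}{V_2(q)}+V_2(q)=\dfrac{\phi(-q^7)\,\mathfrak f(q^4,q^{10})}{q^2\psi(q^{14})\,\mathfrak f(-q^3,-q^{11})}$, \item[(v)] $\dfrac{1}{V_3(q)}-V_3(q)=\dfrac{\phi(q^7)\,\mathfrak f(-q^2,-q^{12})}{q\,\psi(q^{14})\,\mathfrak f(-q^5,-q^{9})}$, \item[(vi)] $\dfrac{1}{V_3(q)}+V_3(q)=\dfrac{\phi(-q^7)\,\mathfrak f(q^2,q^{12})}{q\,\psi(q^{14})\,\mathfrak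 f(-q^5,-q^{9})}$, \item[(vii)] $\displaystyle\prod_{i=1}^{3}\left(\frac{1}{V_i(q)}-V_i(q)\right)=\frac{\phi^3(q^7)\psi(q)}{q^6\psi^3(q^{14})\psi(q^7)}$, \item[(viii)] $\displaystyle\prod_{i=1}^{3}\left(\frac{1}{V_i(q)}+V_i(q)\right)=\frac{\phi^3(-q^7)\phi(-q^{14})}{q^6\psi^3(q^{14})\psi(q^7)\chi(-q^2)\chi(-q)}$. \end{enumerate}
   Context: For complex $\lambda$ and $|q|<1$, $(\lambda;q)_\infty=\prod_{t\ge0}(1-\lambda q^t)$. Ramanujan's general theta function is $\mathfrak f(a,b)=\sum_{t=-\infty}^{\infty}a^{t(t+1)/2}b^{t(t-1)/2}$ for $|ab|<1$; equivalently $\mathfrak f(a,b)=(-a;ab)_\infty(-b;ab)_\infty(ab;ab)_\infty$. Further $\phi(q)=\mathfrak f(q,q)=\sum_{t\in\mathbb Z}q^{t^2}$, $\psi(q)=\mathfrak f(q,q^3)=\sum_{t\ge0}q^{t(t+1)/2}$, and $\chi(q)=(-q;q^2)_\infty$. *)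

(* Defs.v *)
From Stdlib Require Import Reals ZArith Lra.
From Coquelicot Require Import Coquelicot.
Open Scope C_scope.

(* [Series] and [Lim_seq] are only available on [R]; the complex versions are
   taken componentwise.  As in the real case they are total, and meaningful
   when the limit exists (see [Clim_seq_correct], [CSeries_correct]). *)
Definition Clim_seq (u : nat -> C) : C :=
  (real (Lim_seq (fun n => Re (u n))), real (Lim_seq (fun n => Im (u n)))).

Definition CSeries (a : nat -> C) : C := Clim_seq (sum_n a).

Definition CSeriesZ (g : Z -> C) : C :=
  CSeries (fun n => g (Z.of_nat n)) + CSeries (fun n => g (- Z.of_nat (S n))%Z).

Fixpoint Cprod_n (u : nat -> C) (n : nat) : C :=
  match n with
  | O => 1
  | S m => Cprod_n u m * u m
  end.

Definition qpoch_inf (lambda q : C) : C :=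
  Clim_seq (Cprod_n (fun t => 1 - lambda * q ^ t)).

(* Both exponents are nonnegative integers for every t in Z, so [Z.div] is
   exact and [Z.to_nat] loses nothing. *)
Definition ftheta (a b : C) : C :=
  CSeriesZ (fun t => a ^ Z.to_nat (t * (t + 1) / 2) *
                     b ^ Z.to_nat (t * (t - 1) / 2)).

Definition phi (q : C) : C := ftheta q q.

Definition psi (q : C) : C := ftheta q (q ^ 3).

Definition chi (q : C) : C := qpoch_inf (- q) (q ^ 2).

Definition V1 (q : C) : C :=
  q ^ 3 * (ftheta (- q) (- q ^ 27) / ftheta (- q ^ 13) (- q ^ 15)).

Definition V2 (q : C) : C :=
  q ^ 2 * (ftheta (- q ^ 3) (- q ^ 25) / ftheta (- q ^ 11) (- q ^ 17)).

Definition V3 (q : C) : C :=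
  q * (ftheta (- q ^ 5) (- q ^ 23) / ftheta (- q ^ 9) (- q ^ 19)).

Lemma Clim_seq_correct (u : nat -> C) (l : C) :
  filterlim u eventually (locally l) -> Clim_seq u = l.
Proof.
intros H. destruct l as [x y]. unfold Clim_seq.
rewrite (is_lim_seq_unique (fun n => Re (u n)) x).
rewrite (is_lim_seq_unique (fun n => Im (u n)) y).
reflexivity.
- apply is_lim_seq_spec. intros eps.
  assert (P : locally ((x, y) : C) (fun z : C => ball y eps (Im z))).
  { exists eps. intros z Hz. apply Hz. }
  exact (H _ P).
- apply is_lim_seq_spec. intros eps.
  assert (P : locally ((x, y) : C) (fun z : C => ball x eps (Re z))).
  { exists eps. intros z Hz. apply Hz. }
  exact (H _ P).
Qed.

Lemma CSeries_correct (a : nat -> C) (l : C) :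
  is_series a l -> CSeries a = l.
Proof. exact (Clim_seq_correct (sum_n a) l). Qed.

(* Main.v *)
Require Import Defs.
From Stdlib Require Import Reals ZArith Lra Lia.
From Coquelicot Require Import Coquelicot.
Open Scope C_scope.

(** By the Jacobi triple product, [f(a,b) f(-a,-b) = f(-a^2,-b^2) phi(-ab)].
    Splitting the series by the parity of the index gives
    [f(a,b) = f(a^3 b, a b^3) + a f(b/a, a^5 b^3)], and replacing [(a,b)] by [(-a,-b)]
    changes the sign of the second term; hence, with [b = - a c],
    [f(-a^4 c, -a^4 c^3)^2 - a^2 f(-c, -a^8 c^3)^2 = f(-a^2, -a^2 c^2) phi(a^2 c)].
    For [(a,c) = (q^3,q), (q^2,q^3), (q,q^5)] the left side is the numerator of
    [1/V_i - V_i], and with [i a] in place of [a] that of [1/V_i + V_i]. The denominators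
    follow from [f(a,a b^2) f(b,a^2 b) = f(a,b) psi(ab)], again by the triple product, and
    (vii), (viii) follow by splitting q-Pochhammer symbols of base [q^2] into seven of
    base [q^14].

    The triple product itself is the limit, by Tannery's theorem, of the finite identity
    [(-a;ab)_m (-b;ab)_n = sum_{-n <= t <= m} [m+n, t+n] a^(t(t+1)/2) b^(t(t-1)/2)], whose
    induction steps in [m] and in [n] are the two Pascal rules of the Gaussian binomials. *)

(** * Finite sums and Tannery's theorem *)

Lemma plus_minus_cancel {G : AbelianGroup} (x y : G) : plus x (minus y x) = y.
Proof. unfold minus. now rewrite (plus_comm y), plus_assoc, plus_opp_r, plus_zero_l. Qed.

Section FiniteSums.

Context {G : AbelianMonoid}.

Lemma sum_n_head (a : nat -> G) (n : nat) :
  sum_n a (S n) = plus (a 0%nat) (sum_n (fun k => a (S k)) n).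
Proof. unfold sum_n. rewrite sum_Sn_m by lia. now rewrite <- sum_n_m_S. Qed.

Lemma sum_n_rev (a : nat -> G) (n : nat) : sum_n (fun j => a (n - j)%nat) n = sum_n a n.
Proof.
induction n as [|n IH]; [now rewrite !sum_O|].
rewrite sum_n_head, sum_Sn, <- IH, plus_comm. reflexivity.
Qed.

Lemma sum_n_add (a : nat -> G) (n m : nat) :
  sum_n a (n + S m) = plus (sum_n a n) (sum_n (fun j => a (S n + j)%nat) m).
Proof.
induction m as [|m IH].
- now rewrite Nat.add_1_r, sum_Sn, sum_O, Nat.add_0_r.
- rewrite Nat.add_succ_r, !sum_Sn, IH, plus_assoc. now f_equal.
Qed.

Lemma sum_n_even_odd (a : nat -> G) (n : nat) :
  sum_n a (S (2 * n)) =
  plus (sum_n (fun k => a (2 * k)%nat) n) (sum_n (fun k => a (S (2 * k))) n).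
Proof.
induction n as [|n IH]; [now rewrite sum_Sn, !sum_O|].
replace (S (2 * S n)) with (S (S (S (2 * n)))) by lia.
do 2 rewrite (sum_Sn a). rewrite IH, !sum_Sn, <- !plus_assoc.
replace (2 * S n)%nat with (S (S (2 * n))) by lia.
f_equal. rewrite !plus_assoc. f_equal. apply plus_comm.
Qed.

End FiniteSums.

Lemma filterlim_sum_n {T : Type} {K : AbsRing} {V : NormedModule K}
    {F : (T -> Prop) -> Prop} {FF : Filter F} (f : nat -> T -> V) (l : nat -> V) (n : nat) :
  (forall j, filterlim (f j) F (locally (l j))) ->
  filterlim (fun x => sum_n (fun j => f j x) n) F (locally (sum_n l n)).
Proof.
intros Hf. induction n as [|n IH].
- rewrite sum_O. apply filterlim_ext with (f 0%nat); [|apply Hf].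
  intros x. now rewrite sum_O.
- rewrite sum_Sn.
  apply filterlim_ext with (fun x => plus (sum_n (fun j => f j x) n) (f (S n) x)).
  + intros x. now rewrite sum_Sn.
  + apply filterlim_comp_2 with (1 := IH) (2 := Hf (S n)), filterlim_plus.
Qed.

Lemma sum_n_tail_le (a b : nat -> R) (m n : nat) :
  (forall j, (a j <= b j)%R) -> (m <= n)%nat ->
  (sum_n a n - sum_n a m <= sum_n b n - sum_n b m)%R.
Proof.
intros Hab Hmn. induction Hmn as [|n Hmn IH]; [lra|].
rewrite !sum_Sn. unfold plus; simpl. specialize (Hab (S n)). lra.
Qed.

Lemma sum_n_nonneg (a : nat -> R) (n : nat) :
  (forall j, (0 <= a j)%R) -> (0 <= sum_n a n)%R.
Proof.
intros Ha. induction n as [|n IH]; [rewrite sum_O; apply Ha|].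
rewrite sum_Sn. now apply Rplus_le_le_0_compat.
Qed.

Lemma is_lim_seq_sum_n_dominated (b : nat -> nat -> R) (g : nat -> R) :
  (forall n j, (0 <= b n j <= g j)%R) -> ex_series g ->
  (forall j, is_lim_seq (fun n => b n j) 0%R) ->
  is_lim_seq (fun n => sum_n (b n) n) 0%R.
Proof.
intros Hb [s Hs] Hlim.
assert (Htail : is_lim_seq (sum_n g) s) by exact Hs.
apply is_lim_seq_spec in Htail. apply is_lim_seq_spec. intros eps.
destruct (Htail (pos_div_2 (pos_div_2 eps))) as [K HK].
assert (Hhead : is_lim_seq (fun n => sum_n (b n) K) (sum_n (fun _ => 0%R) K))
  by apply (filterlim_sum_n (fun j n => b n j) _ K Hlim).
rewrite sum_n_const, Rmult_0_r in Hhead. apply is_lim_seq_spec in Hhead.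
destruct (Hhead (pos_div_2 eps)) as [N HN].
exists (K + N)%nat. intros n Hn.
pose proof (sum_n_tail_le (b n) g K n (fun j => proj2 (Hb n j)) ltac:(lia)) as Hle.
pose proof (sum_n_nonneg (b n) n (fun j => proj1 (Hb n j))) as Hpos.
pose proof (Rabs_def2 _ _ (HK K (le_n _))) as HgK.
pose proof (Rabs_def2 _ _ (HK n ltac:(lia))) as Hgn.
pose proof (Rabs_def2 _ _ (HN n ltac:(lia))) as HbK.
apply Rabs_def1; simpl in *; lra.
Qed.

Section Tannery.

Context {K : AbsRing} {V : NormedModule K}.

Lemma filterlim_sum_n_dominated_zero (f : nat -> nat -> V) (g : nat -> R) :
  (forall n j, (norm (f n j) <= g j)%R) -> ex_series g ->
  (forall j, filterlim (fun n => f n j) eventually (locally (zero : V))) ->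
  filterlim (fun n => sum_n (f n) n) eventually (locally (zero : V)).
Proof.
intros Hfg Hg Hf. apply filterlim_norm_zero.
apply (is_lim_seq_le_le (fun _ => 0%R) _ (fun n => sum_n (fun j => norm (f n j)) n) 0%R).
- intros n. split; [apply norm_ge_0 | apply norm_sum_n_m].
- apply is_lim_seq_const.
- apply is_lim_seq_sum_n_dominated with g; auto.
  + intros n j. split; [apply norm_ge_0 | apply Hfg].
  + intros j. rewrite <- (norm_zero (V := V)).
    exact (filterlim_comp _ _ _ _ norm _ _ _ (Hf j) (filterlim_norm (zero : V))).
Qed.

Lemma norm_lim_le (u : nat -> V) (l : V) (M : R) :
  filterlim u eventually (locally l) -> (forall n, (norm (u n) <= M)%R) -> (norm l <= M)%R.
Proof.
intros Hu HM. apply (is_lim_seq_le (fun n => norm (u n)) (fun _ => M) (norm l) M); auto.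
- exact (filterlim_comp _ _ _ u norm _ _ _ Hu (filterlim_norm l)).
- apply is_lim_seq_const.
Qed.

Theorem tannery (f : nat -> nat -> V) (g : nat -> R) (l : nat -> V) (s : V) :
  (forall n j, (norm (f n j) <= g j)%R) -> ex_series g ->
  (forall j, filterlim (fun n => f n j) eventually (locally (l j))) ->
  is_series l s ->
  filterlim (fun n => sum_n (f n) n) eventually (locally s).
Proof.
intros Hfg Hg Hf Hs.
assert (Hdiff : filterlim (fun n => sum_n (fun j => minus (f n j) (l j)) n)
                  eventually (locally (zero : V))).
{ apply filterlim_sum_n_dominated_zero with (fun j => (2 * g j)%R).
  - intros n j. eapply Rle_trans; [apply norm_triangle|]. rewrite norm_opp.
    pose proof (norm_lim_le _ _ _ (Hf j) (fun n => Hfg n j)).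
    specialize (Hfg n j). lra.
  - now apply (ex_series_scal (V := R_NormedModule)).
  - intros j.
    pose proof (filterlim_comp_2 _ _ plus (Hf j) (filterlim_const (opp (l j)))
                  (filterlim_plus _ _)) as Hlim.
    exact (eq_ind _ (fun z : V => filterlim _ _ (locally z)) Hlim _ (plus_opp_r (l j))). }
rewrite <- (plus_zero_r s).
apply filterlim_ext with
  (fun n => plus (sum_n l n) (sum_n (fun j => minus (f n j) (l j)) n)).
- intros n. rewrite <- sum_n_plus. apply sum_n_ext. intros j.
  apply (plus_minus_cancel (G := V)).
- apply filterlim_comp_2 with (1 := Hs) (2 := Hdiff), filterlim_plus.
Qed.

End Tannery.

(** * Complex sequences and series *)

Definition is_Clim_seq (u : nat -> C) (l : C) : Prop := filterlim u eventually (locally l).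

Lemma is_Clim_seq_unique (u : nat -> C) (l l' : C) :
  is_Clim_seq u l -> is_Clim_seq u l' -> l = l'.
Proof. apply (filterlim_locally_unique (V := C_NormedModule) u). Qed.

Lemma is_Clim_seq_ext (u v : nat -> C) (l : C) :
  (forall n, u n = v n) -> is_Clim_seq u l -> is_Clim_seq v l.
Proof. apply filterlim_ext. Qed.

Lemma is_Clim_seq_const (c : C) : is_Clim_seq (fun _ => c) c.
Proof. apply filterlim_const. Qed.

Lemma is_Clim_seq_plus (u v : nat -> C) (l m : C) :
  is_Clim_seq u l -> is_Clim_seq v m -> is_Clim_seq (fun n => u n + v n) (l + m).
Proof.
intros Hu Hv.
exact (filterlim_comp_2 _ _ Cplus Hu Hv (filterlim_plus (V := C_NormedModule) l m)).
Qed.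

Lemma is_Clim_seq_mult (u v : nat -> C) (l m : C) :
  is_Clim_seq u l -> is_Clim_seq v m -> is_Clim_seq (fun n => u n * v n) (l * m).
Proof.
intros Hu Hv. apply (filterlim_comp_2 (G := locally (T := AbsRing_UniformSpace C_AbsRing) l)
                       (H := locally m) _ _ Cmult).
- intros P HP. now apply Hu, locally_C.
- exact Hv.
- exact (filterlim_scal (V := C_NormedModule) l m).
Qed.

Lemma is_Clim_seq_Cmod (u : nat -> C) (l : C) :
  is_Clim_seq u l -> is_lim_seq (fun n => Cmod (u n)) (Cmod l).
Proof.
intros Hu. exact (filterlim_comp _ _ _ u Cmod _ _ _ Hu (filterlim_norm (V := C_NormedModule) l)).
Qed.

Lemma is_Clim_seq_subseq (u : nat -> C) (l : C) (s : nat -> nat) :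
  filterlim s eventually eventually -> is_Clim_seq u l -> is_Clim_seq (fun n => u (s n)) l.
Proof. apply filterlim_comp. Qed.

Lemma is_Clim_seq_inv (u : nat -> C) (l : C) :
  l <> 0 -> is_Clim_seq u l -> is_Clim_seq (fun n => / u n) (/ l).
Proof.
intros Hl Hu.
assert (Hl0 : (0 < Cmod l)%R) by now apply Cmod_gt_0.
pose proof (is_Clim_seq_Cmod u l Hu) as Hmod.
assert (Hdiff : is_lim_seq (fun n => Cmod (u n + - l)) 0%R).
{ rewrite <- Cmod_0, <- (Cplus_opp_r l).
  apply is_Clim_seq_Cmod, is_Clim_seq_plus, is_Clim_seq_const; auto. }
assert (Hinv : is_Clim_seq (fun n => / u n + - / l) 0).
{ apply (filterlim_norm_zero (V := C_NormedModule)).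
  apply (is_lim_seq_ext_loc (fun n => Cmod (u n + - l) / (Cmod (u n) * Cmod l))%R _ 0%R).
  - apply is_lim_seq_spec in Hmod. destruct (Hmod (mkposreal _ Hl0)) as [N HN].
    exists N. intros n Hn. specialize (HN n Hn). apply Rabs_def2 in HN. simpl in HN.
    assert (Hun : u n <> 0) by (apply Cmod_gt_0; lra).
    rewrite <- Cmod_mult, <- Cmod_div by now apply Cmult_neq_0.
    rewrite <- Cmod_opp. change (norm (V := C_NormedModule)) with Cmod. f_equal.
    field. auto.
  - replace 0%R with (0 / (Cmod l * Cmod l))%R by (field; lra).
    apply is_lim_seq_div'; [exact Hdiff | | nra].
    now apply is_lim_seq_mult'; [|apply is_lim_seq_const]. }
pose proof (is_Clim_seq_plus _ _ _ _ Hinv (is_Clim_seq_const (/ l))) as Hsum.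
rewrite Cplus_0_l in Hsum. revert Hsum. apply is_Clim_seq_ext. intros n; ring.
Qed.

Lemma Csum_O (a : nat -> C) : sum_n a 0 = a 0%nat :> C.
Proof. exact (sum_O a). Qed.

Lemma Csum_Sn (a : nat -> C) (n : nat) : sum_n a (S n) = sum_n a n + a (S n) :> C.
Proof. exact (sum_Sn a n). Qed.

Lemma Csum_n_ext_loc (a b : nat -> C) (n : nat) :
  (forall k, (k <= n)%nat -> a k = b k) -> sum_n a n = sum_n b n :> C.
Proof. exact (sum_n_ext_loc a b n). Qed.

Lemma Csum_n_mult_l (c : C) (a : nat -> C) (n : nat) :
  sum_n (fun k => c * a k) n = c * sum_n a n :> C.
Proof. exact (sum_n_mult_l (K := C_Ring) c a n). Qed.

Lemma Csum_n_add_shift (x y z : nat -> C) (n : nat) :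
  z 0%nat = x 0%nat -> (forall k, z (S k) = x (S k) + y k) -> x (S n) = 0 ->
  sum_n z (S n) = sum_n (fun k => x k + y k) n.
Proof.
intros Hz0 HzS Hx.
transitivity (sum_n x (S n) + sum_n y n).
- rewrite !sum_n_head, Hz0, (sum_n_ext _ _ _ HzS).
  rewrite (sum_n_plus (fun k => x (S k)) y). exact (plus_assoc (x 0%nat) _ _).
- rewrite Csum_Sn, Hx, Cplus_0_r. symmetry. apply (sum_n_plus x y).
Qed.

Lemma is_series_CSeries (a : nat -> C) (g : nat -> R) :
  (forall n, (Cmod (a n) <= g n)%R) -> ex_series g -> is_series a (CSeries a).
Proof.
intros Hag Hg.
destruct (ex_series_le (V := C_CompleteNormedModule) a g Hag Hg) as [l Hl].
now rewrite (CSeries_correct a l Hl).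
Qed.

Lemma ex_series_eventually_le {K : AbsRing} {V : CompleteNormedModule K}
    (a : nat -> V) (b : nat -> R) :
  eventually (fun n => (norm (a n) <= b n)%R) -> ex_series b -> ex_series a.
Proof.
intros [N HN] Hb. apply (ex_series_incr_n a N).
apply ex_series_le with (fun n => b (N + n)%nat).
- intros n. apply HN. lia.
- now apply (ex_series_incr_n b N).
Qed.

Lemma ex_series_norm_ratio {K : AbsRing} {V : NormedModule K} (a : nat -> V) (r : R) :
  (0 <= r < 1)%R -> eventually (fun n => (norm (a (S n)) <= r * norm (a n))%R) ->
  ex_series (fun n => norm (a n)).
Proof.
intros Hr [N HN].
apply (ex_series_incr_n (fun n => norm (a n)) N).
apply (ex_series_le (V := R_CompleteNormedModule) _ (fun n => norm (a N) * r ^ n)%R).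
- intros n. change (norm (V := R_NormedModule)) with Rabs.
  rewrite Rabs_pos_eq by apply norm_ge_0.
  induction n as [|n IH]; [rewrite Nat.add_0_r; simpl; lra|].
  rewrite Nat.add_succ_r. eapply Rle_trans; [apply HN; lia|]. simpl. nra.
- apply (ex_series_scal_l (V := R_NormedModule)), ex_series_geom.
  rewrite Rabs_pos_eq; lra.
Qed.

(** * Infinite products *)

Lemma Cprod_n_ext (u v : nat -> C) (n : nat) :
  (forall k, u k = v k) -> Cprod_n u n = Cprod_n v n.
Proof. intros E. induction n as [|n IH]; simpl; [|rewrite IH, E]; reflexivity. Qed.

Lemma Cprod_n_mult (u v : nat -> C) (n : nat) :
  Cprod_n (fun k => u k * v k) n = Cprod_n u n * Cprod_n v n.
Proof. induction n as [|n IH]; simpl; [|rewrite IH]; ring. Qed.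

Lemma Cprod_n_add (u : nat -> C) (m n : nat) :
  Cprod_n u (m + n) = Cprod_n u m * Cprod_n (fun k => u (m + k)%nat) n.
Proof.
induction n as [|n IH]; simpl; [rewrite Nat.add_0_r; ring|].
rewrite Nat.add_succ_r; simpl. rewrite IH; ring.
Qed.

Lemma Cprod_n_1 (n : nat) : Cprod_n (fun _ => 1) n = 1.
Proof. induction n as [|n IH]; simpl; [|rewrite IH]; ring. Qed.

Lemma Cprod_n_neq_0 (u : nat -> C) (n : nat) :
  (forall k, u k <> 0) -> Cprod_n u n <> 0.
Proof.
intros Hu. induction n as [|n IH]; simpl; [exact C1_nz | now apply Cmult_neq_0].
Qed.

Lemma is_Clim_seq_Cprod_n (u : nat -> nat -> C) (l : nat -> C) (m : nat) :
  (forall i, is_Clim_seq (u i) (l i)) ->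
  is_Clim_seq (fun n => Cprod_n (fun i => u i n) m) (Cprod_n l m).
Proof.
intros Hu. induction m as [|m IH]; simpl.
- apply is_Clim_seq_const.
- now apply is_Clim_seq_mult.
Qed.

Section InfiniteProducts.

Variable u : nat -> C.
Hypothesis summable_u : ex_series (fun k => Cmod (u k)).

Lemma Cmod_Cprod_n_le_exp (n : nat) :
  (Cmod (Cprod_n (fun k => 1 - u k)%C (S n)) <= exp (sum_n (fun k => Cmod (u k)) n))%R.
Proof.
assert (Hfactor : forall k, (Cmod (1 - u k) <= exp (Cmod (u k)))%R).
{ intros k. eapply Rle_trans; [apply Cmod_triangle|].
  rewrite Cmod_opp, Cmod_1. apply exp_ineq1_le. }
induction n as [|n IH].
- simpl. now rewrite Cmult_1_l, sum_O.
- rewrite sum_Sn. unfold plus; simpl plus. rewrite exp_plus.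
  change (Cprod_n (fun k => 1 - u k) (S (S n)))
    with (Cprod_n (fun k => 1 - u k) (S n) * (1 - u (S n))).
  rewrite Cmod_mult. apply Rmult_le_compat; auto using Cmod_ge_0.
Qed.

Lemma Cprod_n_bounded : exists M, forall n, (Cmod (Cprod_n (fun k => 1 - u k)%C n) <= M)%R.
Proof.
pose proof (Series_correct _ summable_u) as Hs.
exists (exp (Series (fun k => Cmod (u k)))). intros n.
assert (Hle : forall n, (sum_n (fun k => Cmod (u k)) n <= Series (fun k => Cmod (u k)))%R).
{ apply is_lim_seq_incr_compare; [exact Hs|]. intros k.
  rewrite sum_Sn. unfold plus; simpl. pose proof (Cmod_ge_0 (u (S k))). lra. }
destruct n as [|n].
- simpl. rewrite Cmod_1. eapply Rle_trans; [|apply exp_ineq1_le].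
  pose proof (sum_n_nonneg (fun k => Cmod (u k)) 0 (fun k => Cmod_ge_0 _)).
  specialize (Hle 0%nat). lra.
- eapply Rle_trans; [apply Cmod_Cprod_n_le_exp|].
  destruct (Hle n) as [Hlt | ->]; [left; now apply exp_increasing | apply Rle_refl].
Qed.

(* The partial products are the partial sums of their increments [- P_k u_k]. *)
Lemma ex_Clim_seq_Cprod_n : exists l, is_Clim_seq (Cprod_n (fun k => 1 - u k)) l.
Proof.
destruct Cprod_n_bounded as [M HM].
set (P := Cprod_n (fun k => 1 - u k)) in *.
set (d := fun n => match n with O => RtoC 1 | S k => - (P k * u k) end).
assert (Hd : ex_series d).
{ apply (ex_series_incr_1 (V := C_NormedModule) d).
  apply (ex_series_le (V := C_CompleteNormedModule) _ (fun k => M * Cmod (u k))%R).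
  - intros k. change (Cmod (- (P k * u k)) <= M * Cmod (u k))%R.
    rewrite Cmod_opp, Cmod_mult. apply Rmult_le_compat_r; auto using Cmod_ge_0.
  - now apply (ex_series_scal_l (V := R_NormedModule)). }
destruct Hd as [l Hl]. exists l. apply (is_Clim_seq_ext (sum_n d)); [|exact Hl].
intros n. induction n as [|n IH]; [now rewrite Csum_O|].
rewrite Csum_Sn, IH. change (P n + - (P n * u n) = P n * (1 - u n)). ring.
Qed.

End InfiniteProducts.

Lemma Cmod_1_minus_ge (z : C) : (1 - Cmod z <= Cmod (1 - z))%R.
Proof.
pose proof (Cmod_triangle (1 - z) z) as H.
replace (1 - z + z) with (RtoC 1) in H by ring. rewrite Cmod_1 in H. lra.
Qed.

Lemma ex_series_Cmod_div_minus_1 (u : nat -> C) :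
  (forall k, u k <> 1) -> ex_series (fun k => Cmod (u k)) ->
  ex_series (fun k => Cmod (u k / (u k - 1))).
Proof.
intros Hu1 Hu.
apply (ex_series_eventually_le (V := R_CompleteNormedModule) _ (fun k => 2 * Cmod (u k))%R).
- apply ex_series_lim_0, is_lim_seq_spec in Hu as Hlim.
  destruct (Hlim (mkposreal (/ 2) ltac:(lra))) as [N HN].
  exists N. intros k Hk. specialize (HN k Hk). simpl in HN.
  rewrite Rminus_0_r, Rabs_pos_eq in HN by apply Cmod_ge_0.
  change (norm (V := R_NormedModule)) with Rabs. rewrite Rabs_pos_eq by apply Cmod_ge_0.
  pose proof (Cmod_1_minus_ge (u k)) as Hge. pose proof (Cmod_ge_0 (u k)) as Hpos.
  rewrite Cmod_div by now apply Cminus_eq_contra.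
  replace (u k - 1) with (- (1 - u k)) by ring. rewrite Cmod_opp.
  apply Rle_div_l; [lra|]. nra.
- now apply (ex_series_scal_l (V := R_NormedModule)).
Qed.

(* The product of the inverse factors [1 - u/(u-1) = 1/(1-u)] converges as well. *)
Lemma Clim_seq_Cprod_n_neq_0 (u : nat -> C) (l : C) :
  (forall k, u k <> 1) -> ex_series (fun k => Cmod (u k)) ->
  is_Clim_seq (Cprod_n (fun k => 1 - u k)) l -> l <> 0.
Proof.
intros Hu1 Hu Hl ->.
destruct (ex_Clim_seq_Cprod_n _ (ex_series_Cmod_div_minus_1 u Hu1 Hu)) as [l' Hl'].
apply C1_nz. rewrite <- (Cmult_0_l l').
apply (is_Clim_seq_unique (fun _ => 1)); [apply is_Clim_seq_const|].
refine (is_Clim_seq_ext _ _ _ _ (is_Clim_seq_mult _ _ _ _ Hl Hl')).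
intros n. rewrite <- Cprod_n_mult. transitivity (Cprod_n (fun _ => 1) n); [|apply Cprod_n_1].
apply Cprod_n_ext. intros k. field. now apply Cminus_eq_contra.
Qed.

(** * The q-Pochhammer symbol *)

Definition qpoch (x p : C) (n : nat) : C := Cprod_n (fun t => 1 - x * p ^ t) n.

Lemma qpoch_S (x p : C) (n : nat) : qpoch x p (S n) = qpoch x p n * (1 - x * p ^ n).
Proof. reflexivity. Qed.

Lemma qpoch_dissect (x p : C) (m n : nat) :
  qpoch x p (m * n) = Cprod_n (fun i => qpoch (x * p ^ i) (p ^ m) n) m.
Proof.
induction n as [|n IH].
- rewrite Nat.mul_0_r. symmetry. apply Cprod_n_1.
- rewrite Nat.mul_succ_r. unfold qpoch in *. rewrite Cprod_n_add, IH, <- Cprod_n_mult.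
  apply Cprod_n_ext. intros i. simpl. rewrite Cpow_add_r, Cpow_mult_r. ring.
Qed.

Lemma Cmod_pow_lt_1 (x : C) (n : nat) : (0 < n)%nat -> (Cmod x < 1)%R -> (Cmod (x ^ n) < 1)%R.
Proof.
intros Hn Hx. rewrite Cmod_pow. apply pow_lt_1_compat; auto. split; auto using Cmod_ge_0.
Qed.

Section QPochhammerLimit.

Variables x p : C.
Hypothesis p_lt_1 : (Cmod p < 1)%R.

Lemma ex_series_Cmod_geom : ex_series (fun t => Cmod (x * p ^ t)).
Proof.
apply (ex_series_ext (fun t => Cmod x * Cmod p ^ t)%R).
- intros t. now rewrite Cmod_mult, Cmod_pow.
- apply (ex_series_scal_l (V := R_NormedModule)), ex_series_geom.
  rewrite Rabs_pos_eq; auto using Cmod_ge_0.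
Qed.

Lemma is_Clim_seq_qpoch : is_Clim_seq (qpoch x p) (qpoch_inf x p).
Proof.
destruct (ex_Clim_seq_Cprod_n _ ex_series_Cmod_geom) as [l Hl].
replace (qpoch_inf x p) with l; [exact Hl|]. symmetry. now apply Clim_seq_correct.
Qed.

Lemma Cmod_mult_pow_lt_1 (t : nat) : (Cmod x < 1)%R -> (Cmod (x * p ^ t) < 1)%R.
Proof.
intros Hx. rewrite Cmod_mult, Cmod_pow.
pose proof (Cmod_ge_0 x). pose proof (Cmod_ge_0 p).
assert (0 <= Cmod p ^ t <= 1)%R.
{ split; [apply pow_le; lra|]. rewrite <- (pow1 t). apply pow_incr; lra. }
nra.
Qed.

Lemma Cmult_pow_neq_1 (t : nat) : (Cmod x < 1)%R -> x * p ^ t <> 1.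
Proof.
intros Hx E. apply (f_equal Cmod) in E. rewrite Cmod_1 in E.
pose proof (Cmod_mult_pow_lt_1 t Hx). lra.
Qed.

Lemma qpoch_neq_0 (n : nat) : (Cmod x < 1)%R -> qpoch x p n <> 0.
Proof.
intros Hx. apply Cprod_n_neq_0. intros t. apply Cminus_eq_contra. symmetry.
now apply Cmult_pow_neq_1.
Qed.

Lemma qpoch_inf_neq_0 : (Cmod x < 1)%R -> qpoch_inf x p <> 0.
Proof.
intros Hx. apply (Clim_seq_Cprod_n_neq_0 (fun t => x * p ^ t)).
- intros t. now apply Cmult_pow_neq_1.
- apply ex_series_Cmod_geom.
- apply is_Clim_seq_qpoch.
Qed.

End QPochhammerLimit.

Lemma qpoch_inf_dissect (x p : C) (m : nat) : (0 < m)%nat -> (Cmod p < 1)%R ->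
  qpoch_inf x p = Cprod_n (fun i => qpoch_inf (x * p ^ i) (p ^ m)) m.
Proof.
intros Hm Hp. apply is_Clim_seq_unique with (fun n => qpoch x p (m * n)).
- apply is_Clim_seq_subseq; [|now apply is_Clim_seq_qpoch].
  apply eventually_subseq. intros n; nia.
- apply (is_Clim_seq_ext (fun n => Cprod_n (fun i => qpoch (x * p ^ i) (p ^ m) n) m)).
  + intros n. now rewrite qpoch_dissect.
  + apply (is_Clim_seq_Cprod_n (fun i => qpoch (x * p ^ i) (p ^ m))).
    intros i. now apply is_Clim_seq_qpoch, Cmod_pow_lt_1.
Qed.

Lemma qpoch_inf_mult_opp (x p : C) : (Cmod p < 1)%R ->
  qpoch_inf x p * qpoch_inf (- x) p = qpoch_inf (x ^ 2) (p ^ 2).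
Proof.
intros Hp. apply is_Clim_seq_unique with (qpoch (x ^ 2) (p ^ 2)).
- apply (is_Clim_seq_ext (fun n => qpoch x p n * qpoch (- x) p n)).
  + intros n. unfold qpoch. rewrite <- Cprod_n_mult. apply Cprod_n_ext. intros t.
    rewrite <- Cpow_mult_r, (Nat.mul_comm 2 t), Cpow_mult_r. ring.
  + now apply is_Clim_seq_mult; apply is_Clim_seq_qpoch.
- apply is_Clim_seq_qpoch, Cmod_pow_lt_1; auto; lia.
Qed.

Lemma qpoch_inf_dissect2 (x p : C) : (Cmod p < 1)%R ->
  qpoch_inf x p = qpoch_inf x (p ^ 2) * qpoch_inf (x * p) (p ^ 2).
Proof.
intros Hp. rewrite (qpoch_inf_dissect x p 2) by (auto; lia). cbn [Cprod_n].
rewrite Cmult_1_l, Cpow_1_r. now replace (x * p ^ 0) with x by ring.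
Qed.

Lemma qpoch_inf_self_dissect2 (p : C) : (Cmod p < 1)%R ->
  qpoch_inf p p = qpoch_inf p (p ^ 2) * qpoch_inf (p ^ 2) (p ^ 2).
Proof.
intros Hp. rewrite qpoch_inf_dissect2 at 1 by auto.
now replace (p * p) with (p ^ 2) by ring.
Qed.

Lemma chi_opp (p : C) : chi (- p) = qpoch_inf p (p ^ 2).
Proof. unfold chi. f_equal; ring. Qed.

(* Euler: partitions into odd parts and into distinct parts are equinumerous. *)
Lemma chi_opp_mult_qpoch_inf (p : C) : (Cmod p < 1)%R -> chi (- p) * qpoch_inf (- p) p = 1.
Proof.
intros Hp. rewrite chi_opp.
assert (Hp2 : (Cmod (p ^ 2) < 1)%R) by (apply Cmod_pow_lt_1; auto; lia).
pose proof (qpoch_inf_neq_0 _ _ Hp2 Hp2) as Hn.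
pose proof (qpoch_inf_mult_opp p p Hp) as E. rewrite qpoch_inf_self_dissect2 in E by auto.
transitivity (qpoch_inf p (p ^ 2) * qpoch_inf (p ^ 2) (p ^ 2) * qpoch_inf (- p) p
              / qpoch_inf (p ^ 2) (p ^ 2)).
- field. auto.
- rewrite E. field. auto.
Qed.

Lemma chi_opp_neq_0 (p : C) : (Cmod p < 1)%R -> chi (- p) <> 0.
Proof.
intros Hp E. apply C1_nz. rewrite <- (chi_opp_mult_qpoch_inf p Hp), E. ring.
Qed.

(** * Gaussian binomial coefficients *)

Fixpoint gbinom (p : C) (N k : nat) : C :=
  match k, N with
  | O, _ => 1
  | S _, O => 0
  | S j, S M => gbinom p M j + p ^ k * gbinom p M k
  end.

Lemma gbinom_0 (p : C) (N : nat) : gbinom p N 0 = 1.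
Proof. destruct N; reflexivity. Qed.

Lemma gbinom_S (p : C) (N k : nat) :
  gbinom p (S N) (S k) = gbinom p N k + p ^ S k * gbinom p N (S k).
Proof. reflexivity. Qed.

Lemma gbinom_gt (p : C) (N k : nat) : (N < k)%nat -> gbinom p N k = 0.
Proof.
revert k. induction N as [|N IH]; intros [|k] Hk; try lia; [reflexivity|].
rewrite gbinom_S, !IH by lia. ring.
Qed.

Lemma gbinom_absorption (p : C) (N k : nat) :
  (1 - p ^ S k) * gbinom p N (S k) = (1 - p ^ (N - k)) * gbinom p N k.
Proof.
revert k. induction N as [|N IH]; intros k; [simpl; ring|].
destruct (le_lt_dec k N) as [Hk|Hk].
- rewrite gbinom_S, Cmult_plus_distr_l.
  transitivity ((1 - p ^ S k) * gbinom p N k + p ^ S k * ((1 - p ^ S k) * gbinom p N (S k)));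
    [ring|].
  rewrite IH. transitivity ((1 - p ^ S N) * gbinom p N k).
  + replace (S N) with (S k + (N - k))%nat by lia. rewrite Cpow_add_r. ring.
  + destruct k as [|j]; [rewrite !gbinom_0; simpl Nat.sub; ring|].
    replace (S N - S j)%nat with (N - j)%nat by lia.
    rewrite gbinom_S, Cmult_plus_distr_l, <- IH.
    replace (S N) with (S j + (N - j))%nat by lia. rewrite Cpow_add_r. ring.
- rewrite gbinom_gt by lia. replace (S N - k)%nat with 0%nat by lia. simpl; ring.
Qed.

Lemma gbinom_S_dual (p : C) (N k : nat) :
  gbinom p (S N) (S k) = gbinom p N (S k) + p ^ (N - k) * gbinom p N k.
Proof.
pose proof (gbinom_absorption p N k) as E. rewrite gbinom_S.
transitivity (gbinom p N (S k) + gbinom p N k - (1 - p ^ S k) * gbinom p N (S k)); [ring|].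
rewrite E. ring.
Qed.

Lemma gbinom_qpoch (p : C) (N k : nat) : (k <= N)%nat ->
  gbinom p N k * (qpoch p p k * qpoch p p (N - k)) = qpoch p p N.
Proof.
induction k as [|k IH]; intros Hk.
- rewrite gbinom_0, Nat.sub_0_r. unfold qpoch at 1; simpl. ring.
- rewrite <- IH by lia. replace (N - k)%nat with (S (N - S k)) by lia.
  rewrite !qpoch_S, <- !Cpow_S. replace (S (N - S k)) with (N - k)%nat by lia.
  transitivity ((1 - p ^ S k) * gbinom p N (S k) * (qpoch p p k * qpoch p p (N - S k)));
    [ring|].
  rewrite gbinom_absorption. ring.
Qed.

Lemma sum_n_gbinom_S (p : C) (N : nat) (w : nat -> C) :
  sum_n (fun k => gbinom p (S N) k * w k) (S N) =
  sum_n (fun k => gbinom p N k * (p ^ k * w k + w (S k))) N.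
Proof.
rewrite (Csum_n_add_shift (fun k => gbinom p N k * (p ^ k * w k))
           (fun k => gbinom p N k * w (S k))).
- apply sum_n_ext. intros k. symmetry. apply Cmult_plus_distr_l.
- rewrite !gbinom_0. simpl. ring.
- intros k. rewrite gbinom_S. ring.
- rewrite gbinom_gt by lia. ring.
Qed.

Lemma sum_n_gbinom_S_dual (p : C) (N : nat) (w : nat -> C) :
  sum_n (fun k => gbinom p (S N) k * w k) (S N) =
  sum_n (fun k => gbinom p N k * (w k + p ^ (N - k) * w (S k))) N.
Proof.
rewrite (Csum_n_add_shift (fun k => gbinom p N k * w k)
           (fun k => gbinom p N k * (p ^ (N - k) * w (S k)))).
- apply sum_n_ext. intros k. symmetry. apply Cmult_plus_distr_l.
- now rewrite !gbinom_0.
- intros k. rewrite gbinom_S_dual. ring.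
- rewrite gbinom_gt by lia. ring.
Qed.

Section GaussianBinomialLimit.

Variable p : C.
Hypothesis p_lt_1 : (Cmod p < 1)%R.

Lemma gbinom_qpoch_quotient (N k : nat) : (k <= N)%nat ->
  gbinom p N k = qpoch p p N * (/ qpoch p p k * / qpoch p p (N - k)).
Proof.
intros Hk. rewrite <- (gbinom_qpoch p N k Hk). field.
split; now apply qpoch_neq_0.
Qed.

Lemma is_Clim_seq_inv_qpoch : is_Clim_seq (fun n => / qpoch p p n) (/ qpoch_inf p p).
Proof. apply is_Clim_seq_inv; [now apply qpoch_inf_neq_0 | now apply is_Clim_seq_qpoch]. Qed.

Lemma gbinom_bounded : exists M, forall N k, (Cmod (gbinom p N k) <= M)%R.
Proof.
destruct (filterlim_bounded (V := C_NormedModule) _ (ex_intro _ _ (is_Clim_seq_qpoch p p p_lt_1)))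
  as [A HA].
destruct (filterlim_bounded (V := C_NormedModule) _ (ex_intro _ _ is_Clim_seq_inv_qpoch))
  as [B HB].
change (norm (V := C_NormedModule)) with Cmod in HA, HB.
assert (HA0 : (0 <= A)%R) by (eapply Rle_trans; [apply Cmod_ge_0 | apply (HA 0%nat)]).
exists (A * (B * B))%R. intros N k. destruct (le_lt_dec k N) as [Hk|Hk].
- rewrite gbinom_qpoch_quotient, !Cmod_mult by exact Hk.
  repeat (apply Rmult_le_compat; auto using Cmod_ge_0, Rmult_le_pos).
- rewrite gbinom_gt, Cmod_0 by exact Hk.
  apply Rmult_le_pos; [exact HA0 | apply Rle_0_sqr].
Qed.

Lemma is_Clim_seq_gbinom (N k : nat -> nat) :
  filterlim k eventually eventually ->
  filterlim (fun n => N n - k n)%nat eventually eventually ->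
  is_Clim_seq (fun n => gbinom p (N n) (k n)) (/ qpoch_inf p p).
Proof.
intros Hk HNk.
assert (Hle : eventually (fun n => (k n < N n)%nat)).
{ destruct (HNk _ (ex_intro _ 1%nat (fun n Hn => Hn))) as [n0 Hn0].
  exists n0. intros n Hn. specialize (Hn0 n Hn). simpl in Hn0. lia. }
assert (HN : filterlim N eventually eventually).
{ intros P [n0 HP]. destruct Hle as [n1 Hn1].
  destruct (Hk _ (ex_intro _ n0 (fun n Hn => Hn))) as [n2 Hn2].
  exists (n1 + n2)%nat. intros n Hn. apply HP.
  specialize (Hn1 n ltac:(lia)). specialize (Hn2 n ltac:(lia)). simpl in Hn2. lia. }
pose proof (qpoch_inf_neq_0 p p p_lt_1 p_lt_1) as Hn.
replace (/ qpoch_inf p p) with (qpoch_inf p p * (/ qpoch_inf p p * / qpoch_inf p p))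
  by (field; auto).
apply (filterlim_ext_loc
         (fun n => qpoch p p (N n) * (/ qpoch p p (k n) * / qpoch p p (N n - k n)))).
- destruct Hle as [n0 Hn0]. exists n0. intros n Hn'. symmetry. apply gbinom_qpoch_quotient.
  specialize (Hn0 n Hn'). lia.
- apply is_Clim_seq_mult; [|apply is_Clim_seq_mult].
  + now apply (is_Clim_seq_subseq (qpoch p p)), is_Clim_seq_qpoch.
  + now apply (is_Clim_seq_subseq (fun n => / qpoch p p n)), is_Clim_seq_inv_qpoch.
  + now apply (is_Clim_seq_subseq (fun n => / qpoch p p n) _ (fun n => N n - k n)%nat),
      is_Clim_seq_inv_qpoch.
Qed.

End GaussianBinomialLimit.

(** * Bilateral series *)

(* The sum of [g t] over [-n-1 <= t <= n]. *)
Definition sum_nZ (g : Z -> C) (n : nat) : C :=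
  sum_n (fun k => g (Z.of_nat k)) n + sum_n (fun k => g (- Z.of_nat (S k))%Z) n.

Definition is_seriesZ (g : Z -> C) (l : C) : Prop := is_Clim_seq (sum_nZ g) l.

Lemma sum_nZ_ext (g h : Z -> C) (n : nat) : (forall t, g t = h t) -> sum_nZ g n = sum_nZ h n.
Proof. intros E. unfold sum_nZ. f_equal; apply sum_n_ext; intros k; apply E. Qed.

Lemma is_seriesZ_ext (g h : Z -> C) (l : C) :
  (forall t, g t = h t) -> is_seriesZ g l -> is_seriesZ h l.
Proof. intros E. apply is_Clim_seq_ext. intros n. now apply sum_nZ_ext. Qed.

Lemma is_seriesZ_mult_l (c : C) (g : Z -> C) (l : C) :
  is_seriesZ g l -> is_seriesZ (fun t => c * g t) (c * l).
Proof.
intros Hg. apply (is_Clim_seq_ext (fun n => c * sum_nZ g n)).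
- intros n. unfold sum_nZ. rewrite Cmult_plus_distr_l. symmetry.
  f_equal; apply Csum_n_mult_l.
- apply is_Clim_seq_mult; [apply is_Clim_seq_const | exact Hg].
Qed.

Lemma sum_nZ_even_odd (g : Z -> C) (n : nat) :
  sum_nZ g (S (2 * n)) = sum_nZ (fun t => g (2 * t)%Z) n + sum_nZ (fun t => g (2 * t + 1)%Z) n.
Proof.
unfold sum_nZ. rewrite !sum_n_even_odd.
assert (E : forall (x y : nat -> Z), (forall k, x k = y k) ->
              sum_n (fun k => g (x k)) n = sum_n (fun k => g (y k)) n :> C)
  by (intros x y Hxy; apply sum_n_ext; intros k; now rewrite Hxy).
rewrite (E (fun k => Z.of_nat (2 * k)) (fun k => (2 * Z.of_nat k)%Z)) by lia.
rewrite (E (fun k => Z.of_nat (S (2 * k))) (fun k => (2 * Z.of_nat k + 1)%Z)) by lia.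
rewrite (E (fun k => - Z.of_nat (S (2 * k)))%Z (fun k => (2 * - Z.of_nat (S k) + 1)%Z)) by lia.
rewrite (E (fun k => - Z.of_nat (S (S (2 * k))))%Z (fun k => (2 * - Z.of_nat (S k))%Z)) by lia.
change (@plus C_AbelianMonoid) with Cplus. ring.
Qed.

Lemma is_seriesZ_even_odd (g : Z -> C) (l0 l1 l : C) :
  is_seriesZ (fun t => g (2 * t)%Z) l0 -> is_seriesZ (fun t => g (2 * t + 1)%Z) l1 ->
  is_seriesZ g l -> l = l0 + l1.
Proof.
intros H0 H1 Hg. apply is_Clim_seq_unique with (fun n => sum_nZ g (S (2 * n))).
- apply (is_Clim_seq_subseq (sum_nZ g) _ (fun n => S (2 * n))); [|exact Hg].
  apply eventually_subseq. intros n; lia.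
- eapply is_Clim_seq_ext; [intros n; symmetry; apply sum_nZ_even_odd|].
  now apply is_Clim_seq_plus.
Qed.

(** * The Jacobi triple product *)

Definition theta_term (a b : C) (t : Z) : C :=
  a ^ Z.to_nat (t * (t + 1) / 2) * b ^ Z.to_nat (t * (t - 1) / 2).

Lemma theta_term_of_exponents (a b : C) (t : Z) (e f : nat) :
  (2 * Z.of_nat e = t * (t + 1))%Z -> (2 * Z.of_nat f = t * (t - 1))%Z ->
  theta_term a b t = a ^ e * b ^ f.
Proof.
intros He Hf. unfold theta_term. rewrite <- He, <- Hf, !(Z.mul_comm 2).
now rewrite !Z.div_mul, !Nat2Z.id by lia.
Qed.

Lemma ex_theta_exponents (t : Z) :
  exists e f : nat, (2 * Z.of_nat e = t * (t + 1))%Z /\ (2 * Z.of_nat f = t * (t - 1))%Z.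
Proof.
destruct (Z.Even_or_Odd t) as [[s ->]|[s ->]].
- exists (Z.to_nat (s * (2 * s + 1))), (Z.to_nat (s * (2 * s - 1))).
  split; rewrite Z2Nat.id; destruct (Z.le_gt_cases 0 s); nia.
- exists (Z.to_nat ((2 * s + 1) * (s + 1))), (Z.to_nat ((2 * s + 1) * s)).
  split; rewrite Z2Nat.id; destruct (Z.le_gt_cases 0 s); nia.
Qed.

Lemma theta_term_opp (a b : C) (t : Z) : theta_term a b (- t) = theta_term b a t.
Proof.
destruct (ex_theta_exponents t) as (e & f & He & Hf).
rewrite (theta_term_of_exponents b a t e f), (theta_term_of_exponents a b (- t) f e) by lia. ring.
Qed.

(* This is [theta_term a b (t + 1) = a (ab)^t theta_term a b t], with the factors
   distributed so that no exponent is negative. *)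
Lemma theta_term_succ (a b : C) (t : Z) (m r : nat) : Z.of_nat r = (Z.of_nat m - t)%Z ->
  (a * b) ^ r * theta_term a b (t + 1) = a * (a * b) ^ m * theta_term a b t.
Proof.
intros Hr. destruct (ex_theta_exponents t) as (e & f & He & Hf).
destruct (Z_of_nat_complete (Z.of_nat e + t + 1) ltac:(nia)) as [e' He'].
rewrite (theta_term_of_exponents a b t e f), (theta_term_of_exponents a b (t + 1) e' e) by lia.
rewrite !Cpow_mult_l.
transitivity (a ^ (r + e') * b ^ (r + e)); [rewrite !Cpow_add_r; ring|].
replace (r + e')%nat with (S (m + e)) by lia.
replace (r + e)%nat with (m + f)%nat by lia.
rewrite Cpow_S, !Cpow_add_r. ring.
Qed.

Lemma theta_term_pred (a b : C) (t : Z) (n r : nat) : Z.of_nat r = (Z.of_nat n + t)%Z ->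
  (a * b) ^ r * theta_term a b (t - 1) = b * (a * b) ^ n * theta_term a b t.
Proof.
intros Hr. rewrite <- (theta_term_opp b a (t - 1)), <- (theta_term_opp b a t), (Cmult_comm a b).
replace (- (t - 1))%Z with (- t + 1)%Z by ring. apply theta_term_succ. lia.
Qed.

Lemma finite_jacobi_triple_product (a b : C) (m n : nat) :
  qpoch (- a) (a * b) m * qpoch (- b) (a * b) n =
  sum_n (fun k => gbinom (a * b) (m + n) k * theta_term a b (Z.of_nat k - Z.of_nat n)) (m + n).
Proof.
set (p := a * b). induction m as [|m IHm].
- induction n as [|n IHn].
  + rewrite Csum_O. unfold qpoch, theta_term; simpl. ring.
  + simpl Nat.add in *. rewrite qpoch_S, Cmult_assoc, IHn, sum_n_gbinom_S.
    rewrite Cmult_comm, <- Csum_n_mult_l. apply Csum_n_ext_loc. intros k _.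
    pose proof (theta_term_pred a b (Z.of_nat k - Z.of_nat n) n k ltac:(lia)) as E.
    fold p in E.
    replace (Z.of_nat k - Z.of_nat (S n))%Z with (Z.of_nat k - Z.of_nat n - 1)%Z by lia.
    replace (Z.of_nat (S k) - Z.of_nat (S n))%Z with (Z.of_nat k - Z.of_nat n)%Z by lia.
    rewrite E. ring.
- simpl Nat.add. rewrite qpoch_S, sum_n_gbinom_S_dual.
  transitivity ((1 - - a * p ^ m) * (qpoch (- a) p m * qpoch (- b) p n)); [ring|].
  rewrite IHm, <- Csum_n_mult_l. apply Csum_n_ext_loc. intros k Hk.
  pose proof (theta_term_succ a b (Z.of_nat k - Z.of_nat n) m (m + n - k) ltac:(lia)) as E.
  fold p in E.
  replace (Z.of_nat (S k) - Z.of_nat n)%Z with (Z.of_nat k - Z.of_nat n + 1)%Z by lia.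
  rewrite E. ring.
Qed.

Lemma ex_series_theta_term (a b : C) : (Cmod (a * b) < 1)%R ->
  ex_series (fun n => Cmod (theta_term a b (Z.of_nat n))).
Proof.
intros Hab.
apply (ex_series_norm_ratio (V := C_NormedModule) (fun n => theta_term a b (Z.of_nat n)) (/ 2));
  [lra|].
assert (Hlim : is_lim_seq (fun n => Cmod (a * (a * b) ^ n)) 0%R)
  by now apply ex_series_lim_0, ex_series_Cmod_geom.
apply is_lim_seq_spec in Hlim. destruct (Hlim (mkposreal (/ 2) ltac:(lra))) as [N HN].
exists N. intros n Hn. specialize (HN n Hn). simpl in HN.
rewrite Rminus_0_r, Rabs_pos_eq in HN by apply Cmod_ge_0.
pose proof (theta_term_succ a b (Z.of_nat n) n 0 ltac:(lia)) as E.
change ((a * b) ^ 0) with (RtoC 1) in E. rewrite Cmult_1_l in E.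
change (norm (V := C_NormedModule)) with Cmod.
rewrite Nat2Z.inj_succ. unfold Z.succ. rewrite E, Cmod_mult.
apply Rmult_le_compat_r; [apply Cmod_ge_0 | lra].
Qed.

Lemma ex_series_theta_term_neg (a b : C) : (Cmod (a * b) < 1)%R ->
  ex_series (fun n => Cmod (theta_term a b (- Z.of_nat (S n)))).
Proof.
intros Hab. apply (ex_series_ext (fun n => Cmod (theta_term b a (Z.of_nat (S n))))).
- intros n. now rewrite theta_term_opp.
- apply (ex_series_incr_1 (fun n => Cmod (theta_term b a (Z.of_nat n)))).
  apply ex_series_theta_term. now rewrite Cmult_comm.
Qed.

Lemma is_seriesZ_ftheta (a b : C) : (Cmod (a * b) < 1)%R ->
  is_seriesZ (theta_term a b) (ftheta a b).
Proof.
intros Hab. apply is_Clim_seq_plus; refine (is_series_CSeries _ _ (fun n => Rle_refl _) _).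
- now apply ex_series_theta_term.
- now apply ex_series_theta_term_neg.
Qed.

Lemma is_Clim_seq_sum_n_gbinom (p : C) (u : nat -> C) (N : nat -> nat) (k : nat -> nat -> nat) :
  (Cmod p < 1)%R -> ex_series (fun j => Cmod (u j)) ->
  (forall j, filterlim (fun n => k n j) eventually eventually) ->
  (forall j, filterlim (fun n => N n - k n j)%nat eventually eventually) ->
  is_Clim_seq (fun n => sum_n (fun j => gbinom p (N n) (k n j) * u j) n)
    (/ qpoch_inf p p * CSeries u).
Proof.
intros Hp Hu Hk HNk. destruct (gbinom_bounded p Hp) as [M HM].
apply (tannery (V := C_NormedModule) (fun n j => gbinom p (N n) (k n j) * u j)
         (fun j => M * Cmod (u j))%R (fun j => / qpoch_inf p p * u j)).
- intros n j. change (norm (V := C_NormedModule)) with Cmod. rewrite Cmod_mult.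
  apply Rmult_le_compat_r; [apply Cmod_ge_0 | apply HM].
- now apply (ex_series_scal_l (V := R_NormedModule)).
- intros j. apply is_Clim_seq_mult; [now apply is_Clim_seq_gbinom | apply is_Clim_seq_const].
- apply (is_series_scal_l (V := C_NormedModule)).
  exact (is_series_CSeries u _ (fun j => Rle_refl _) Hu).
Qed.

Lemma finite_jacobi_triple_product_halves (a b : C) (n : nat) :
  qpoch (- a) (a * b) n * qpoch (- b) (a * b) (S n) =
  sum_n (fun j => gbinom (a * b) (n + S n) (S n + j) * theta_term a b (Z.of_nat j)) n +
  sum_n (fun j => gbinom (a * b) (n + S n) (n - j) * theta_term a b (- Z.of_nat (S j))) n.
Proof.
rewrite finite_jacobi_triple_product.
etransitivity; [apply sum_n_add|]. etransitivity; [apply plus_comm|].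
apply (f_equal2 Cplus).
- apply Csum_n_ext_loc. intros j _. do 2 f_equal. lia.
- rewrite <- sum_n_rev. apply Csum_n_ext_loc. intros j Hj. do 2 f_equal. lia.
Qed.

Theorem jacobi_triple_product (a b p : C) : a * b = p -> (Cmod p < 1)%R ->
  ftheta a b = qpoch_inf (- a) p * qpoch_inf (- b) p * qpoch_inf p p.
Proof.
intros <- Hp.
assert (E : qpoch_inf (- a) (a * b) * qpoch_inf (- b) (a * b) =
            / qpoch_inf (a * b) (a * b) * ftheta a b).
{ apply is_Clim_seq_unique with
    (fun n => qpoch (- a) (a * b) n * qpoch (- b) (a * b) (S n)).
  - apply is_Clim_seq_mult; [|apply (is_Clim_seq_subseq (qpoch (- b) (a * b)) _ S)];
      try now apply is_Clim_seq_qpoch.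
    apply eventually_subseq. intros n; lia.
  - eapply is_Clim_seq_ext;
      [intros n; symmetry; apply finite_jacobi_triple_product_halves|].
    change (ftheta a b) with (CSeries (fun n => theta_term a b (Z.of_nat n)) +
                              CSeries (fun n => theta_term a b (- Z.of_nat (S n)))).
    rewrite Cmult_plus_distr_l.
    apply is_Clim_seq_plus; apply is_Clim_seq_sum_n_gbinom;
      auto using ex_series_theta_term, ex_series_theta_term_neg;
      intros j; apply eventually_subseq_loc; exists j; intros n Hn; lia. }
rewrite E. field. now apply qpoch_inf_neq_0.
Qed.

(** * Theta function identities *)

Lemma Cmod_mult_lt_1 (x y : C) : (Cmod x < 1)%R -> (Cmod y < 1)%R -> (Cmod (x * y) < 1)%R.
Proof.
intros Hx Hy. rewrite Cmod_mult. pose proof (Cmod_ge_0 x). pose proof (Cmod_ge_0 y). nra.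
Qed.

Lemma jacobi_triple_product_opp (x y p : C) : x * y = p -> (Cmod p < 1)%R ->
  ftheta (- x) (- y) = qpoch_inf x p * qpoch_inf y p * qpoch_inf p p.
Proof.
intros E Hp. rewrite (jacobi_triple_product (- x) (- y) p); [|rewrite <- E; ring | exact Hp].
now replace (- - x) with x by ring; replace (- - y) with y by ring.
Qed.

Lemma ftheta_sym (a b : C) : (Cmod (a * b) < 1)%R -> ftheta a b = ftheta b a.
Proof.
intros Hab.
rewrite (jacobi_triple_product a b (a * b)), (jacobi_triple_product b a (a * b))
  by (auto; ring).
ring.
Qed.

Lemma ftheta_neq_0 (a b : C) : (Cmod a < 1)%R -> (Cmod b < 1)%R -> ftheta a b <> 0.
Proof.
intros Ha Hb. pose proof (Cmod_mult_lt_1 a b Ha Hb) as Hab.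
rewrite (jacobi_triple_product a b (a * b)) by auto.
repeat apply Cmult_neq_0; apply qpoch_inf_neq_0; rewrite ?Cmod_opp; auto.
Qed.

Lemma phi_opp (p : C) : (Cmod p < 1)%R -> phi (- p) = chi (- p) * qpoch_inf p p.
Proof.
intros Hp. unfold phi.
rewrite (jacobi_triple_product_opp p p (p ^ 2)), chi_opp, (qpoch_inf_self_dissect2 p)
  by (auto using Cmod_pow_lt_1 || ring).
ring.
Qed.

Lemma psi_eq_qpoch_inf (p : C) : (Cmod p < 1)%R ->
  psi p = qpoch_inf (- p) p * qpoch_inf (p ^ 2) (p ^ 2).
Proof.
intros Hp. assert (Hp2 : (Cmod (p ^ 2) < 1)%R) by (apply Cmod_pow_lt_1; auto; lia).
assert (Hp4 : (Cmod ((p ^ 2) ^ 2) < 1)%R) by (apply Cmod_pow_lt_1; auto; lia).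
unfold psi. rewrite (jacobi_triple_product p (p ^ 3) ((p ^ 2) ^ 2)) by (auto; ring).
rewrite <- (qpoch_inf_mult_opp (p ^ 2) (p ^ 2)) by exact Hp2.
rewrite (qpoch_inf_dissect2 (- p) p), (qpoch_inf_dissect2 (- p) (p ^ 2)) by auto.
replace (- p * p ^ 2) with (- p ^ 3) by ring. replace (- p * p) with (- p ^ 2) by ring. ring.
Qed.

Lemma ftheta_mult_opp (a b : C) : (Cmod (a * b) < 1)%R ->
  ftheta a b * ftheta (- a) (- b) = ftheta (- a ^ 2) (- b ^ 2) * phi (- (a * b)).
Proof.
intros Hp. set (p := a * b) in *.
assert (Hp2 : (Cmod (p ^ 2) < 1)%R) by (apply Cmod_pow_lt_1; auto; lia).
rewrite (jacobi_triple_product a b p), (jacobi_triple_product_opp a b p), phi_opp, chi_opp,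
  (jacobi_triple_product_opp (a ^ 2) (b ^ 2) (p ^ 2)) by (auto; unfold p; ring).
rewrite <- (qpoch_inf_mult_opp a p), <- (qpoch_inf_mult_opp b p),
  (qpoch_inf_self_dissect2 p) by exact Hp.
ring.
Qed.

Lemma ftheta_mult_psi (a b : C) : (Cmod (a * b) < 1)%R ->
  ftheta a (b * (a * b)) * ftheta b (a * (a * b)) = ftheta a b * psi (a * b).
Proof.
intros Hp. set (p := a * b) in *.
assert (Hp2 : (Cmod (p ^ 2) < 1)%R) by (apply Cmod_pow_lt_1; auto; lia).
rewrite (jacobi_triple_product a (b * p) (p ^ 2)), (jacobi_triple_product b (a * p) (p ^ 2)),
  (jacobi_triple_product a b p), psi_eq_qpoch_inf by (auto; unfold p; ring).
rewrite (qpoch_inf_dissect2 (- a) p), (qpoch_inf_dissect2 (- b) p),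
  <- (qpoch_inf_mult_opp p p) by exact Hp.
replace (- a * p) with (- (a * p)) by ring. replace (- b * p) with (- (b * p)) by ring.
ring.
Qed.

Lemma theta_term_even (a c : C) (t : Z) :
  theta_term a (a * c) (2 * t) = theta_term (a ^ 4 * c) (a ^ 4 * c ^ 3) t.
Proof.
destruct (ex_theta_exponents t) as (e & f & He & Hf).
rewrite (theta_term_of_exponents _ _ t e f),
  (theta_term_of_exponents _ _ (2 * t) (3 * e + f) (e + 3 * f)) by nia.
rewrite !Cpow_mult_l, <- !Cpow_mult_r.
transitivity (a ^ (3 * e + f + (e + 3 * f)) * c ^ (e + 3 * f));
  [rewrite (Cpow_add_r a (3 * e + f)); ring|].
replace (3 * e + f + (e + 3 * f))%nat with (4 * e + 4 * f)%nat by lia.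
rewrite !Cpow_add_r. ring.
Qed.

Lemma theta_term_odd (a c : C) (t : Z) :
  theta_term a (a * c) (2 * t + 1) = a * theta_term (a ^ 8 * c ^ 3) c t.
Proof.
destruct (ex_theta_exponents t) as (e & f & He & Hf).
assert (Hle : (3 * e + f <= S (8 * e))%nat) by nia.
rewrite (theta_term_of_exponents _ _ t e f),
  (theta_term_of_exponents _ _ (2 * t + 1) (S (8 * e) - (3 * e + f)) (3 * e + f)) by nia.
rewrite !Cpow_mult_l, <- !Cpow_mult_r.
transitivity (a ^ (S (8 * e) - (3 * e + f) + (3 * e + f)) * c ^ (3 * e + f));
  [rewrite (Cpow_add_r a _ (3 * e + f)); ring|].
rewrite Nat.sub_add, Cpow_S, Cpow_add_r by exact Hle. ring.
Qed.

Ltac congr_ring := first [reflexivity | ring | progress f_equal; congr_ring].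

Lemma ftheta_dissect2 (a b c : C) : (Cmod (a * b) < 1)%R -> b = a * c ->
  ftheta a b = ftheta (a ^ 3 * b) (a * b ^ 3) + a * ftheta c (a ^ 5 * b ^ 3).
Proof.
intros Hp ->.
assert (Hp4 : forall p, p = (a * (a * c)) ^ 4 -> (Cmod p < 1)%R)
  by (intros p ->; apply Cmod_pow_lt_1; auto; lia).
rewrite (ftheta_sym c) by (apply Hp4; ring).
apply (is_seriesZ_even_odd (theta_term a (a * c))); [| |now apply is_seriesZ_ftheta].
- apply (is_seriesZ_ext (theta_term (a ^ 4 * c) (a ^ 4 * c ^ 3))).
  + intros t. now rewrite theta_term_even.
  + replace (a ^ 3 * (a * c)) with (a ^ 4 * c) by ring.
    replace (a * (a * c) ^ 3) with (a ^ 4 * c ^ 3) by ring.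
    apply is_seriesZ_ftheta, Hp4. ring.
- apply (is_seriesZ_ext (fun t => a * theta_term (a ^ 8 * c ^ 3) c t)).
  + intros t. now rewrite theta_term_odd.
  + replace (a ^ 5 * (a * c) ^ 3) with (a ^ 8 * c ^ 3) by ring.
    apply is_seriesZ_mult_l, is_seriesZ_ftheta, Hp4. ring.
Qed.

Lemma ftheta_sqr_minus (a c : C) : (Cmod (a ^ 2 * c) < 1)%R ->
  ftheta (- (a ^ 4 * c)) (- (a ^ 4 * c ^ 3)) ^ 2 - a ^ 2 * ftheta (- c) (- (a ^ 8 * c ^ 3)) ^ 2 =
  ftheta (- a ^ 2) (- (a ^ 2 * c ^ 2)) * phi (a ^ 2 * c).
Proof.
intros Hp.
assert (Hp' : (Cmod (a * - (a * c)) < 1)%R).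
{ replace (a * - (a * c)) with (- (a ^ 2 * c)) by ring. now rewrite Cmod_opp. }
transitivity (ftheta a (- (a * c)) * ftheta (- a) (- - (a * c))).
- rewrite (ftheta_dissect2 a (- (a * c)) (- c)), (ftheta_dissect2 (- a) (- - (a * c)) (- c))
    by (ring || now replace (- a * - - (a * c)) with (a * - (a * c)) by ring).
  set (x := ftheta (- (a ^ 4 * c)) _). set (y := ftheta (- c) _).
  transitivity ((x + a * y) * (x + - a * y)); [ring|].
  unfold x, y. congr_ring.
- rewrite ftheta_mult_opp by exact Hp'. congr_ring.
Qed.

(* The substitution [a -> Ci * a] turns the difference into a sum. *)
Lemma ftheta_sqr_plus (a c : C) : (Cmod (a ^ 2 * c) < 1)%R ->
  ftheta (- (a ^ 4 * c)) (- (a ^ 4 * c ^ 3)) ^ 2 + a ^ 2 * ftheta (- c) (- (a ^ 8 * c ^ 3)) ^ 2 =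
  ftheta (a ^ 2) (a ^ 2 * c ^ 2) * phi (- (a ^ 2 * c)).
Proof.
intros Hp.
assert (I2 : (Ci * a) ^ 2 = - a ^ 2).
{ transitivity (Ci * Ci * a ^ 2); [ring|].
  replace (Ci * Ci) with (- (1)) by (apply injective_projections; simpl; ring). ring. }
assert (I4 : (Ci * a) ^ 4 = a ^ 4) by (transitivity (((Ci * a) ^ 2) ^ 2); [|rewrite I2]; ring).
assert (I8 : (Ci * a) ^ 8 = a ^ 8) by (transitivity (((Ci * a) ^ 4) ^ 2); [|rewrite I4]; ring).
pose proof (ftheta_sqr_minus (Ci * a) c) as E. rewrite I2, I4, I8 in E.
transitivity (ftheta (- - a ^ 2) (- (- a ^ 2 * c ^ 2)) * phi (- a ^ 2 * c)); [|congr_ring].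
rewrite <- E; [ring|]. now replace (- a ^ 2 * c) with (- (a ^ 2 * c)) by ring; rewrite Cmod_opp.
Qed.

(** * The quotients and their products *)

Lemma Cinv_0 : / 0 = 0.
Proof. apply injective_projections; simpl; unfold Rdiv; ring. Qed.

Lemma Cinv_mult (x y : C) : / (x * y) = / x * / y.
Proof.
destruct (Ceq_dec x 0) as [->|Hx]; [rewrite Cmult_0_l, Cinv_0; ring|].
destruct (Ceq_dec y 0) as [->|Hy]; [rewrite Cmult_0_r, Cinv_0; ring|].
field. auto.
Qed.

Lemma Cdiv_mult_Cdiv (x y z w : C) : x / y * (z / w) = x * z / (y * w).
Proof. unfold Cdiv. rewrite Cinv_mult. ring. Qed.

Lemma Cmult3_quotients_common_factor (q f p x1 x2 x3 y1 y2 y3 : C) :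
  f * x1 / (q ^ 3 * p * y1) * (f * x2 / (q ^ 2 * p * y2)) * (f * x3 / (q * p * y3)) =
  f ^ 3 / (q ^ 6 * p ^ 3) * (x1 * x2 * x3 / (y1 * y2 * y3)).
Proof. rewrite !Cdiv_mult_Cdiv. f_equal; ring. Qed.

Lemma Cdiv_eq_cross (x y z w : C) : y <> 0 -> w <> 0 -> x * w = z * y -> x / y = z / w.
Proof.
intros Hy Hw E. transitivity (x * w / (y * w)); [field; auto|]. rewrite E. field. auto.
Qed.

(* Division by zero yields [0], so no side condition is needed; this is what makes the
   theorem true at [q = 0]. *)
Lemma Cinv_plus_mult_quotient (s a x y : C) :
  1 / (a * (x / y)) + s * (a * (x / y)) = (y ^ 2 + s * (a ^ 2 * x ^ 2)) / (a * (x * y)).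
Proof.
unfold Cdiv.
destruct (Ceq_dec a 0) as [->|Ha]; [rewrite !Cmult_0_l, !Cinv_0; ring|].
destruct (Ceq_dec x 0) as [->|Hx]; [rewrite !Cmult_0_l, !Cmult_0_r, !Cinv_0; ring|].
destruct (Ceq_dec y 0) as [->|Hy]; [rewrite Cinv_0, !Cmult_0_r, !Cinv_0; ring|].
field. auto.
Qed.

Definition theta_ratio (a c : C) : C :=
  a * (ftheta (- c) (- (a ^ 8 * c ^ 3)) / ftheta (- (a ^ 4 * c)) (- (a ^ 4 * c ^ 3))).

Section ThetaRatio.

Variables a c : C.
Hypothesis a2c_lt_1 : (Cmod (a ^ 2 * c) < 1)%R.

Lemma theta_ratio_denominator :
  ftheta (- c) (- (a ^ 8 * c ^ 3)) * ftheta (- (a ^ 4 * c)) (- (a ^ 4 * c ^ 3)) =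
  psi (a ^ 4 * c ^ 2) * ftheta (- c) (- (a ^ 4 * c)).
Proof.
set (x := - c). set (y := - (a ^ 4 * c)).
transitivity (ftheta x (y * (x * y)) * ftheta y (x * (x * y)));
  [unfold x, y; congr_ring|].
rewrite ftheta_mult_psi, Cmult_comm; [unfold x, y; congr_ring|].
replace (x * y) with ((a ^ 2 * c) ^ 2) by (unfold x, y; ring).
apply Cmod_pow_lt_1; auto; lia.
Qed.

Lemma inv_minus_theta_ratio :
  1 / theta_ratio a c - theta_ratio a c =
  phi (a ^ 2 * c) * ftheta (- a ^ 2) (- (a ^ 2 * c ^ 2)) /
  (a * psi (a ^ 4 * c ^ 2) * ftheta (- c) (- (a ^ 4 * c))).
Proof.
transitivity (1 / theta_ratio a c + - (1) * theta_ratio a c); [ring|]. unfold theta_ratio.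
rewrite Cinv_plus_mult_quotient, theta_ratio_denominator.
rewrite (Cmult_comm (phi _)), <- ftheta_sqr_minus by exact a2c_lt_1.
congr_ring.
Qed.

Lemma inv_plus_theta_ratio :
  1 / theta_ratio a c + theta_ratio a c =
  phi (- (a ^ 2 * c)) * ftheta (a ^ 2) (a ^ 2 * c ^ 2) /
  (a * psi (a ^ 4 * c ^ 2) * ftheta (- c) (- (a ^ 4 * c))).
Proof.
transitivity (1 / theta_ratio a c + 1 * theta_ratio a c); [ring|]. unfold theta_ratio.
rewrite Cinv_plus_mult_quotient, theta_ratio_denominator.
rewrite (Cmult_comm (phi _)), <- ftheta_sqr_plus by exact a2c_lt_1.
congr_ring.
Qed.

End ThetaRatio.

Lemma V1_theta_ratio (q : C) : V1 q = theta_ratio (q ^ 3) q.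
Proof. unfold V1, theta_ratio. congr_ring. Qed.

Lemma V2_theta_ratio (q : C) : V2 q = theta_ratio (q ^ 2) (q ^ 3).
Proof. unfold V2, theta_ratio. congr_ring. Qed.

Lemma V3_theta_ratio (q : C) : V3 q = theta_ratio q (q ^ 5).
Proof. unfold V3, theta_ratio. congr_ring. Qed.

Definition theta_prod_odd (q : C) : C :=
  ftheta (- q) (- q ^ 13) * ftheta (- q ^ 3) (- q ^ 11) * ftheta (- q ^ 5) (- q ^ 9).

Definition theta_prod_even (q : C) : C :=
  ftheta (- q ^ 6) (- q ^ 8) * ftheta (- q ^ 4) (- q ^ 10) * ftheta (- q ^ 2) (- q ^ 12).

Definition theta_prod_even_pos (q : C) : C :=
  ftheta (q ^ 6) (q ^ 8) * ftheta (q ^ 4) (q ^ 10) * ftheta (q ^ 2) (q ^ 12).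

Section ThetaProducts.

Variable q : C.
Hypothesis q_lt_1 : (Cmod q < 1)%R.

Let pow_lt_1 (n : nat) : (Cmod (q ^ S n) < 1)%R.
Proof. apply Cmod_pow_lt_1; [lia | exact q_lt_1]. Qed.

Lemma qpoch_inf_sqr_dissect7 (x : C) :
  qpoch_inf x (q ^ 2) =
  qpoch_inf x (q ^ 14) * qpoch_inf (x * q ^ 2) (q ^ 14) * qpoch_inf (x * q ^ 4) (q ^ 14) *
  qpoch_inf (x * q ^ 6) (q ^ 14) * qpoch_inf (x * q ^ 8) (q ^ 14) *
  qpoch_inf (x * q ^ 10) (q ^ 14) * qpoch_inf (x * q ^ 12) (q ^ 14).
Proof.
rewrite (qpoch_inf_dissect x (q ^ 2) 7) by (lia || apply pow_lt_1).
cbn [Cprod_n]. rewrite Cmult_1_l. congr_ring.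
Qed.

Lemma theta_prod_odd_eq_qpoch_inf :
  theta_prod_odd q = chi (- q) * qpoch_inf (- q ^ 7) (q ^ 7) * qpoch_inf (q ^ 14) (q ^ 14) ^ 3.
Proof.
unfold theta_prod_odd.
rewrite (jacobi_triple_product_opp q (q ^ 13) (q ^ 14)),
  (jacobi_triple_product_opp (q ^ 3) (q ^ 11) (q ^ 14)),
  (jacobi_triple_product_opp (q ^ 5) (q ^ 9) (q ^ 14)) by (ring || apply pow_lt_1).
pose proof (chi_opp_mult_qpoch_inf (q ^ 7) (pow_lt_1 6)) as Euler7.
rewrite chi_opp, <- Cpow_mult_r in Euler7. simpl Nat.mul in Euler7.
rewrite chi_opp, qpoch_inf_sqr_dissect7, <- !Cpow_S. ring [Euler7].
Qed.

Lemma theta_prod_even_eq_qpoch_inf :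
  theta_prod_even q = qpoch_inf (q ^ 2) (q ^ 2) * qpoch_inf (q ^ 14) (q ^ 14) ^ 2.
Proof.
unfold theta_prod_even.
rewrite (jacobi_triple_product_opp (q ^ 6) (q ^ 8) (q ^ 14)),
  (jacobi_triple_product_opp (q ^ 4) (q ^ 10) (q ^ 14)),
  (jacobi_triple_product_opp (q ^ 2) (q ^ 12) (q ^ 14)) by (ring || apply pow_lt_1).
rewrite qpoch_inf_sqr_dissect7, <- !Cpow_add_r. simpl Nat.add. ring.
Qed.

Lemma theta_prod_even_pos_eq_qpoch_inf :
  theta_prod_even_pos q =
  qpoch_inf (- q ^ 2) (q ^ 2) * chi (- q ^ 14) * qpoch_inf (q ^ 14) (q ^ 14) ^ 3.
Proof.
unfold theta_prod_even_pos.
rewrite (jacobi_triple_product (q ^ 6) (q ^ 8) (q ^ 14)),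
  (jacobi_triple_product (q ^ 4) (q ^ 10) (q ^ 14)),
  (jacobi_triple_product (q ^ 2) (q ^ 12) (q ^ 14)) by (ring || apply pow_lt_1).
assert (E : forall n, - q ^ 2 * q ^ n = - q ^ (2 + n)) by (intros n; rewrite Cpow_add_r; ring).
rewrite qpoch_inf_sqr_dissect7, !E. simpl Nat.add.
pose proof (chi_opp_mult_qpoch_inf (q ^ 14) (pow_lt_1 13)) as Euler14.
ring [Euler14].
Qed.

Lemma theta_prod_even_mult_psi : theta_prod_even q * psi (q ^ 7) = psi q * theta_prod_odd q.
Proof.
rewrite theta_prod_even_eq_qpoch_inf, theta_prod_odd_eq_qpoch_inf, !psi_eq_qpoch_inf
  by (exact q_lt_1 || apply pow_lt_1).
rewrite <- Cpow_mult_r. simpl Nat.mul.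
pose proof (chi_opp_mult_qpoch_inf q q_lt_1) as Euler.
ring [Euler].
Qed.

Lemma theta_prod_even_pos_mult_psi :
  theta_prod_even_pos q * (psi (q ^ 7) * chi (- q ^ 2) * chi (- q)) =
  phi (- q ^ 14) * theta_prod_odd q.
Proof.
rewrite theta_prod_even_pos_eq_qpoch_inf, theta_prod_odd_eq_qpoch_inf, psi_eq_qpoch_inf, phi_opp
  by apply pow_lt_1.
rewrite <- Cpow_mult_r. simpl Nat.mul.
pose proof (chi_opp_mult_qpoch_inf (q ^ 2) (pow_lt_1 1)) as Euler2.
ring [Euler2].
Qed.

Lemma theta_prod_odd_neq_0 : theta_prod_odd q <> 0.
Proof.
unfold theta_prod_odd. repeat apply Cmult_neq_0; apply ftheta_neq_0; rewrite Cmod_opp;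
  (exact (pow_lt_1 _) || exact q_lt_1).
Qed.

Lemma psi_pow7_neq_0 : psi (q ^ 7) <> 0.
Proof.
unfold psi. apply ftheta_neq_0; [|apply Cmod_pow_lt_1; [lia|]]; apply pow_lt_1.
Qed.

Lemma theta_prod_even_div_odd : theta_prod_even q / theta_prod_odd q = psi q / psi (q ^ 7).
Proof.
apply Cdiv_eq_cross.
- exact theta_prod_odd_neq_0.
- exact psi_pow7_neq_0.
- exact theta_prod_even_mult_psi.
Qed.

Lemma theta_prod_even_pos_div_odd :
  theta_prod_even_pos q / theta_prod_odd q =
  phi (- q ^ 14) / (psi (q ^ 7) * chi (- q ^ 2) * chi (- q)).
Proof.
apply Cdiv_eq_cross.
- exact theta_prod_odd_neq_0.
- repeat apply Cmult_neq_0.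
  + exact psi_pow7_neq_0.
  + apply chi_opp_neq_0, pow_lt_1.
  + now apply chi_opp_neq_0.
- exact theta_prod_even_pos_mult_psi.
Qed.

End ThetaProducts.

Theorem theorem2p2 (q : C) (hq : (Cmod q < 1)%R) :
  (1 / V1 q - V1 q =
    (phi (q ^ 7) * ftheta (- q ^ 6) (- q ^ 8)) /
    (q ^ 3 * psi (q ^ 14) * ftheta (- q) (- q ^ 13))) /\
  (1 / V1 q + V1 q =
    (phi (- q ^ 7) * ftheta (q ^ 6) (q ^ 8)) /
    (q ^ 3 * psi (q ^ 14) * ftheta (- q) (- q ^ 13))) /\
  (1 / V2 q - V2 q =
    (phi (q ^ 7) * ftheta (- q ^ 4) (- q ^ 10)) /
    (q ^ 2 * psi (q ^ 14) * ftheta (- q ^ 3) (- q ^ 11))) /\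
  (1 / V2 q + V2 q =
    (phi (- q ^ 7) * ftheta (q ^ 4) (q ^ 10)) /
    (q ^ 2 * psi (q ^ 14) * ftheta (- q ^ 3) (- q ^ 11))) /\
  (1 / V3 q - V3 q =
    (phi (q ^ 7) * ftheta (- q ^ 2) (- q ^ 12)) /
    (q * psi (q ^ 14) * ftheta (- q ^ 5) (- q ^ 9))) /\
  (1 / V3 q + V3 q =
    (phi (- q ^ 7) * ftheta (q ^ 2) (q ^ 12)) /
    (q * psi (q ^ 14) * ftheta (- q ^ 5) (- q ^ 9))) /\
  ((1 / V1 q - V1 q) * (1 / V2 q - V2 q) * (1 / V3 q - V3 q) =
    (phi (q ^ 7) ^ 3 * psi q) /
    (q ^ 6 * psi (q ^ 14) ^ 3 * psi (q ^ 7))) /\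
  ((1 / V1 q + V1 q) * (1 / V2 q + V2 q) * (1 / V3 q + V3 q) =
    (phi (- q ^ 7) ^ 3 * phi (- q ^ 14)) /
    (q ^ 6 * psi (q ^ 14) ^ 3 * psi (q ^ 7) * chi (- q ^ 2) * chi (- q))).
Proof.
assert (level_lt_1 : forall m k, (m * 2 + k)%nat = 7%nat -> (Cmod ((q ^ m) ^ 2 * q ^ k) < 1)%R).
{ intros m k E. rewrite <- Cpow_mult_r, <- Cpow_add_r, E. apply Cmod_pow_lt_1; [lia | exact hq]. }
pose proof (inv_minus_theta_ratio _ _ (level_lt_1 3%nat 1%nat eq_refl)) as V1_minus.
pose proof (inv_plus_theta_ratio _ _ (level_lt_1 3%nat 1%nat eq_refl)) as V1_plus.
pose proof (inv_minus_theta_ratio _ _ (level_lt_1 2%nat 3%nat eq_refl)) as V2_minus.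
pose proof (inv_plus_theta_ratio _ _ (level_lt_1 2%nat 3%nat eq_refl)) as V2_plus.
pose proof (inv_minus_theta_ratio _ _ (level_lt_1 1%nat 5%nat eq_refl)) as V3_minus.
pose proof (inv_plus_theta_ratio _ _ (level_lt_1 1%nat 5%nat eq_refl)) as V3_plus.
rewrite <- !Cpow_mult_r, <- !Cpow_add_r in *. simpl Nat.mul in *. simpl Nat.add in *.
rewrite !Cpow_1_r in *.
rewrite <- V1_theta_ratio in *. rewrite <- V2_theta_ratio in *. rewrite <- V3_theta_ratio in *.
repeat (split; [assumption|]). split.
- rewrite V1_minus, V2_minus, V3_minus, Cmult3_quotients_common_factor.
  fold (theta_prod_even q) (theta_prod_odd q).
  rewrite theta_prod_even_div_odd, Cdiv_mult_Cdiv by exact hq. congr_ring.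
- rewrite V1_plus, V2_plus, V3_plus, Cmult3_quotients_common_factor.
  fold (theta_prod_even_pos q) (theta_prod_odd q).
  rewrite theta_prod_even_pos_div_odd, Cdiv_mult_Cdiv by exact hq. congr_ring.
Qed.
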